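(* If an end $[E_k]$ of $\Omega$ has a singleton impression, i.e. $I[E_k]=\{x\}$ for some $x\in\partial\Omega$, then it is a prime end.
   Context: Setting: $(X,d,\mu)$ is a metric measure space with more than one point, $\mu$ is a Borel measure with $0<\mu(B)<\infty$ for all balls $B$, and $1\le p<\infty$ is fixed. $X$ is complete, $\mu$ is doubling (there is $C_\mu>0$ with $\mu(B(x,2r))\le C_\mu\mu(B(x,r))$ for all balls), and $X$ supports a $p$-Poincaré inequality: there are $C_{PI}>0$, $\lambda\ge1$ such that for all balls $B$ and all $u\in N^{1,p}(X)$, $\frac{1}{\mu(B)}\int_B|u-u_B|\,d\mu\le C_{PI}\operatorname{diam}(B)\bigl(\frac{1}{\mu(\lambda B)}\int_{\lambda B}g_u^p\,d\mu\bigr)^{1/p}$, where $u_B=\frac{1}{\mu(B)}\int_B u\,d\mu$. Here a nonnegative Borel function $g$ is an upper gradient of $u:X\to[-\infty,\infty]$ if for every nonconstant rectifiable curve $\gamma:[0,l_\gamma]\to X$ parameterized by arc length, $|u(\gamma(0))-u(\gamma(l_\gamma))|\le\int_\gamma g\,ds$ when both values are finite, and $\int_\gamma g\,ds=\infty$ otherwise; $N^{1,p}(X)$ is the space of measurable $u$ with $\int_X|u|^p\,d\mu+\inf_g\int_X g^p\,d\mu<\infty$ (infimum over upper gradients $g$ of $u$), and $g_u$ is the minimal $p$-weak upper gradient of $u$ (the a.e.-smallest $L^p$ function satisfying the upper gradient inequality for all curves except a family $\Gamma$ for which some nonnegative Borel $\rho\in L^p(X)$ has $\int_\gamma\rho\,ds=\infty$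 for all $\gamma\in\Gamma$). $\Omega\subsetneq X$ is a bounded domain (bounded nonempty connected open set); closures and boundaries of subsets of $\Omega$ are taken in $X$. Ends: A bounded connected set $E\subsetneq\Omega$ is acceptable if $\overline E\cap\partial\Omega\ne\varnothing$. A sequence $\{E_k\}_{k=1}^\infty$ of acceptable sets is a chain if (i) $E_{k+1}\subset E_k$ for all $k$; (ii) $\operatorname{dist}(\Omega\cap\partial E_{k+1},\Omega\cap\partial E_k)>0$ for all $k$; (iii) the impression $\bigcap_{k=1}^\infty\overline{E}_k$ is contained in $\partial\Omega$. A chain $\{E_k\}$ divides a chain $\{F_k\}$ if for each $k$ there is $l$ with $E_l\subset F_k$. Two chains are equivalent if they divide each other; an end $[E_k]$ is an equivalence class of chains, and its impression $I[E_k]$ is the impression of any representative chain. Division is well defined between ends. A prime end is an end that is not divisible by any other end. *)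

(* Defs.v *)
From HB Require Import structures.
From mathcomp Require Export all_boot all_order all_algebra.
From mathcomp Require Export all_classical all_reals all_analysis.
From mathcomp Require Export measurable_realfun.

Set Implicit Arguments.
Unset Strict Implicit.
Unset Printing Implicit Defensive.

Import Order.TTheory GRing.Theory Num.Theory.
Import numFieldNormedType.Exports.

Local Open Scope classical_set_scope.
Local Open Scope ring_scope.
Local Open Scope ereal_scope.

(* The sigma-algebra is not tied to the topology here: "Borel measure" is the
   hypothesis [borel_measurable_sets] below, which allows the Borel sigma-algebra
   as well as any extension of it, e.g. the completion. *)
#[short(type="completeMetricMeasurableType")]
HB.structure Definition CompleteMetricMeasurable (R : realType) d :=
  {X of Complete X & Metric R X & Measurable d X}.

Section metric_notions.
Context {R : realType} {d : measure_display}
  {X : completeMetricMeasurableType R d}.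
Implicit Types A B : set X.

Definition borel_measurable_sets := forall A, open A -> measurable A.

Definition boundary A : set X := closure A `\` interior A.

Definition bounded_in_metric A := exists x r, A `<=` ball x r.

Definition diam A : \bar R := ereal_sup [set (mdist x y)%:E | x in A & y in A].

(* Equal to +oo as soon as one of the two sets is empty. *)
Definition set_dist A B : \bar R :=
  ereal_inf [set (mdist x y)%:E | x in A & y in B].

End metric_notions.
Arguments borel_measurable_sets {R d} X.

Section curves.
Context {R : realType} {d : measure_display}
  (X : completeMetricMeasurableType R d).

(* Length of the restriction of [gamma] to [a, b]; the sums are those of
   [variation], with the metric of [X] in place of the absolute value. *)
Definition curve_length (gamma : R -> X) (a b : R) : \bar R :=
  ereal_sup [set (let F := gamma \o nth b (a :: s) in
                  \sum_(0 <= n < size s) mdist (F n) (F n.+1))%R%:E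
            | s in itv_partition a b].

(* Nonconstant rectifiable curves parameterized by arc length on
   [0, curve_len]; the values outside this interval are irrelevant. *)
Record curve := Curve {
  curve_len : R ;
  curve_fun :> R -> X ;
  curve_len_ge0 : (0 <= curve_len)%R ;
  curve_continuous : {within `[0%R, curve_len], continuous curve_fun} ;
  curve_rectifiable : curve_length curve_fun 0%R curve_len < +oo ;
  curve_arclength : forall s t : R,
    (0 <= s)%R -> (s <= t)%R -> (t <= curve_len)%R ->
    curve_length curve_fun s t = (t - s)%:E ;
  curve_nonconstant : exists s t : R,
    [/\ (0 <= s <= curve_len)%R, (0 <= t <= curve_len)%R &
        curve_fun s <> curve_fun t] }.

Definition line_integral (c : curve) (g : X -> \bar R) : \bar R :=
  \int[lebesgue_measure]_(t in `[0%R, curve_len c]) g (c t).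

End curves.

Section newtonian.
Context {R : realType} {d : measure_display}
  {X : completeMetricMeasurableType R d}.
Variables (mu : {measure set X -> \bar R}) (p : R).
Implicit Types u g : X -> \bar R.

Definition nonneg_borel_fun g :=
  (forall x, 0 <= g x) /\
  @measurable_fun _ _ (g_sigma_algebraType (@open X)) _ setT g.

Definition upper_gradient_ineq u g (c : curve X) :=
  let ux := u (c 0%R) in let uy := u (c (curve_len c)) in
  let finite := (ux \is a fin_num) && (uy \is a fin_num) in
  (finite -> `|ux - uy| <= line_integral c g) /\
  (~~ finite -> line_integral c g = +oo).

Definition upper_gradient u g :=
  nonneg_borel_fun g /\ forall c : curve X, upper_gradient_ineq u g c.

Definition newtonian u :=
  measurable_fun setT u /\
  \int[mu]_x (`|u x| `^ p) +
    ereal_inf [set \int[mu]_x (g x `^ p) | g in upper_gradient u] < +oo.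

Definition exceptional_family (Gamma : set (curve X)) :=
  exists rho : X -> \bar R,
    [/\ nonneg_borel_fun rho, \int[mu]_x (rho x `^ p) < +oo &
        forall c, Gamma c -> line_integral c rho = +oo].

(* Unlike upper gradients, p-weak upper gradients need not be Borel: they are
   measurable for the sigma-algebra of mu. *)
Definition Lp_weak_upper_gradient u g :=
  [/\ forall x, 0 <= g x, measurable_fun setT g, \int[mu]_x (g x `^ p) < +oo &
      exists2 Gamma, exceptional_family Gamma &
        forall c, ~ Gamma c -> upper_gradient_ineq u g c].

Definition minimal_weak_upper_gradient u g :=
  Lp_weak_upper_gradient u g /\
  forall h, Lp_weak_upper_gradient u h -> {ae mu, forall x, g x <= h x}.

Definition mean (B : set X) u : \bar R := (mu B)^-1 * \int[mu]_(x in B) u x.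

Definition poincare_inequality :=
  exists C lambda : R, [/\ (0 < C)%R, (1 <= lambda)%R &
    forall (x : X) (r : R) u g, (0 < r)%R ->
      newtonian u -> minimal_weak_upper_gradient u g ->
      mean (ball x r) (fun y => `|u y - mean (ball x r) u|) <=
      C%:E * diam (ball x r) *
        (mean (ball x (lambda * r)%R) (fun y => g y `^ p)) `^ p^-1].

Definition doubling := exists2 C : R, (0 < C)%R &
  forall (x : X) (r : R), (0 < r)%R ->
    mu (ball x (2 * r)%R) <= C%:E * mu (ball x r).

End newtonian.

Section prime_ends.
Context {R : realType} {d : measure_display}
  {X : completeMetricMeasurableType R d}.
Implicit Types (Omega : set X) (E F : nat -> set X).

Definition bounded_domain Omega :=
  [/\ bounded_in_metric Omega, Omega !=set0, connected Omega & open Omega].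

Definition acceptable Omega (A : set X) :=
  [/\ bounded_in_metric A, connected A, A `<` Omega &
      closure A `&` boundary Omega !=set0].

Definition impression E : set X := \bigcap_k closure (E k).

Definition chain Omega E :=
  [/\ forall k, acceptable Omega (E k),
      forall k, E k.+1 `<=` E k,
      forall k, 0 < set_dist (Omega `&` boundary (E k.+1))
                             (Omega `&` boundary (E k)) &
      impression E `<=` boundary Omega].

Definition divides E F := forall k, exists l, E l `<=` F k.

Definition equivalent_chains E F := divides E F /\ divides F E.

(* The end [E_k], as a set of chains. *)
Definition end_of Omega E : set (nat -> set X) :=
  [set F | chain Omega F /\ equivalent_chains E F].

Definition is_end Omega (e : set (nat -> set X)) :=
  exists2 E, chain Omega E & e = end_of Omega E.

Definition end_divides (e f : set (nat -> set X)) :=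
  exists E F, [/\ e E, f F & divides E F].

Definition prime_end Omega (e : set (nat -> set X)) :=
  is_end Omega e /\
  forall f, is_end Omega f -> f <> e -> ~ end_divides f e.

End prime_ends.

(* Main.v *)
(* If [F] divides [E] but [E] does not divide [F], some [F k] contains no [E l].
   Every [E l] is connected, meets every [F i], and for [i >= k] is not contained
   in [F i], so it meets the boundaries of both [F k] and [F k.+1], which lie at
   a positive distance from each other.  But closed bounded sets are compact in a
   complete doubling space, so the sets [closure (E l)], which decrease to a
   single point, have diameters tending to 0: a contradiction. *)
Require Import Defs.
From mathcomp Require Import all_boot all_order all_algebra.
From mathcomp Require Import all_classical all_reals all_analysis.

Set Implicit Arguments.
Unset Strict Implicit.
Unset Printing Implicit Defensive.

Import Order.TTheory GRing.Theory Num.Theory.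
Import numFieldNormedType.Exports.

Local Open Scope classical_set_scope.
Local Open Scope ring_scope.

(** * Connected sets and nested compact sets *)

Section metric_topology.
Context {R : realType}.

Lemma metric_ball_open (T : metricType R) (x : T) (r : R) : open (ball x r).
Proof.
rewrite openE => y; rewrite ballEmdist/= => xyr.
rewrite /interior -nbhs_ballE; exists (r - mdist x y) => /=.
  by rewrite subr_gt0.
move=> z; rewrite !ballEmdist/= ltrBrDl.
exact: le_lt_trans (metric_triangle _ _ _).
Qed.

(** If [A] avoided the boundary of [B], then [closure B] and the interior of [B] would cut out the
    same part of [A]. This part is nonempty, open and closed in [A], hence all of [A], which would
    then lie in [B]. *)
Lemma connected_meets_boundary (T : topologicalType) (A B : set T) :
  connected A -> A `&` B !=set0 -> ~ A `<=` B ->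
  A `&` (closure B `\` B°) !=set0.
Proof.
move=> cA [a [Aa Ba]] nAB; absurd_not => AB0.
have ABE : A `&` closure B = A `&` B°.
  apply/seteqP; split=> z [Az Bz]; split => //.
    exact: AB0.
  by apply: subset_closure; apply: interior_subset Bz.
apply: nAB; rewrite -(cA (A `&` B°)).
- by move=> z [_ /interior_subset].
- by rewrite -ABE; exists a; split=> //; exact: subset_closure.
- by exists B° => //; exact: open_interior.
- by exists (closure B) => //; exact: closed_closure.
Qed.

(** Otherwise the differences of [K k] and [U] generate a proper filter containing the compact
    [K 0]. Being closed, they all contain its cluster point, which is then in every [K k] but not in
    [U]. *)
Lemma nested_compact_sub (T : topologicalType) (K : nat -> set T) (U : set T) :
  compact (K 0) -> (forall k, closed (K k)) -> (forall k, K k.+1 `<=` K k) ->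
  open U -> \bigcap_k K k `<=` U -> exists k, K k `<=` U.
Proof.
move=> K0 clK Kdecr oU KU.
have Kle m n : (m <= n)%N -> K n `<=` K m.
  move=> /subnK <-; elim: (n - m)%N => [//|i IH].
  by apply: subset_trans IH; exact: Kdecr.
absurd_not => nKU.
pose G := filter_from [set: nat] (fun k => K k `\` U).
have GF : ProperFilter G.
  apply: filter_from_proper; last first.
    by move=> k _; have [z] := nKU k; exists z.
  apply: filter_from_filter; first by exists 0%N.
  move=> i j _ _; exists (maxn i j) => // z [Kz nUz].
  by split; split=> //; apply: Kle Kz; rewrite ?leq_maxl ?leq_maxr.
have GK0 : G (K 0%N) by exists 0%N => // z [].
have [p [_ Gp]] := K0 G GF GK0.
have {}Gp k : (K k `\` U) p.
  have <- : closure (K k `\` U) = K k `\` U.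
    by apply/esym/closure_id; rewrite setDE; apply: closedI => //; exact: open_closedC.
  by move=> V Vp; apply: Gp => //; exists k.
by have [_] := Gp 0%N; apply; apply: KU => k _; have [] := Gp k.
Qed.

End metric_topology.

(** * Compactness from doubling and completeness *)

Section doubling_compact.
Context {R : realType} {d : measure_display}
  {X : completeMetricMeasurableType R d} (mu : {measure set X -> \bar R}).
Hypothesis borel_mu : borel_measurable_sets X.
Hypothesis mu_ball : forall (x : X) (r : R), 0 < r ->
  (0 < mu (ball x r) < +oo)%E.
Hypothesis mu_doubling : doubling mu.

Let measurable_ball (x : X) (r : R) : measurable (ball x r).
Proof. by apply: borel_mu; exact: (@metric_ball_open R X). Qed.

(** For [y] in [ball x r], the ball of radius [r + r] about [y] contains [ball x r]. The number [m]
    of doublings from [e] to [r + r] does not depend on [y], so neither does [c]. *)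
Lemma doubling_ball_lower_bound (x : X) (r e : R) : 0 < r -> 0 < e ->
  exists2 c : R, 0 < c & forall y, ball x r y -> (c%:E <= mu (ball y e))%E.
Proof.
move=> r0 e0; have [C C0 muC] := mu_doubling.
have iterC m y : (mu (ball y (2 ^+ m * e)) <= (C ^+ m)%:E * mu (ball y e))%E.
  elim: m => [|m IH]; first by rewrite !expr0 mul1r mul1e.
  rewrite !exprS -mulrA EFinM -muleA.
  apply: le_trans (muC _ _ _) _; first by rewrite mulr_gt0// exprn_gt0.
  by apply: lee_pmul => //; rewrite lee_fin ltW.
have [m mP] : exists m, r + r <= 2 ^+ m * e.
  exists (Num.bound ((r + r) / e)); rewrite -ler_pdivrMr//.
  have /archi_boundP/ltW/le_trans -> // : 0 <= (r + r) / e.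
    by rewrite divr_ge0 ?addr_ge0 ?ltW.
  by rewrite -natrX ler_nat ltnW// ltn_expl.
have /andP[mu0 muoo] := mu_ball x r0.
have muE : (fine (mu (ball x r)))%:E = mu (ball x r).
  by rewrite fineK// ge0_fin_numE.
exists (fine (mu (ball x r)) / C ^+ m).
  by rewrite divr_gt0 ?exprn_gt0// -lte_fin muE.
move=> y xy; have Cm0 : 0 < C ^+ m by rewrite exprn_gt0.
rewrite mulrC EFinM muE -(@lee_pmul2l _ (C ^+ m)%:E)//.
rewrite muleA -EFinM divff ?gt_eqF// mul1e.
apply: le_trans (iterC m y); apply: le_measure; rewrite ?inE//.
move=> z xz; apply: (le_ball mP).
by apply: ball_triangle xz; exact: ball_sym.
Qed.

(* Packing: as long as no ball of radius [e] is in the ultrafilter, it contains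
   the complement of every finite union of such balls, which leaves room for one
   more ball of radius [e / 2] disjoint from those already chosen. *)
Lemma ultra_ball_cauchy_ex (F : set_system X) (x : X) (r : R) :
  UltraFilter F -> 0 < r -> F (ball x r) -> cauchy_ex F.
Proof.
move=> UF r0 Fx e e0; absurd_not => nF.
have {}nF y : F (~` ball y e).
  by have [/nF|] := in_ultra_setVsetC (ball y e) UF.
have e20 : 0 < e / 2 by rewrite divr_gt0.
have [c c0 cP] := doubling_ball_lower_bound x r0 e20.
(* Outside [near_set U], the ball of radius [e / 2] about a point misses [U]. *)
pose near_set (U : set X) := \bigcup_(z in U) ball z (e / 2).
have pack n : exists U : set X, [/\ measurable U, U `<=` ball x (r + e / 2),
    ((c *+ n)%:E <= mu U)%E & F (~` near_set U)].
  elim: n => [|n [U [mU Ux cU FU]]].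
    exists set0; split => //; rewrite ?measure0//.
    by rewrite /near_set bigcup_set0 setC0; exact: filterT.
  have [y [xy nUy]] := filter_ex (filterI Fx FU).
  exists (U `|` ball y (e / 2)); split.
  - exact: measurableU.
  - by rewrite subUset; split=> // z yz; apply: ball_triangle xy yz.
  - rewrite measureU//; last first.
      apply/seteqP; split=> z // [Uz yz]; apply: nUy.
      by exists z => //; exact: ball_sym.
    by rewrite mulrSr EFinD; apply: leeD => //; exact: cP.
  (* A point within [e / 2] of the new ball is within [e] of its centre [y], which [nF y]
     excludes. *)
  - apply: filterS (filterI FU (nF y)) => z [nUz nyz] [w [Uw|yw] wz].
      by apply: nUz; exists w.
    by apply: nyz; apply: ball_split yw wz.
have re0 : 0 < r + e / 2 by rewrite addr_gt0.
have /andP[mu0 muoo] := mu_ball x re0.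
(* All chosen balls lie in one ball of finite measure and each adds at least [c], so their number is
   bounded. *)
have [n] : exists n, (mu (ball x (r + e / 2)) < (c *+ n)%:E)%E.
  exists (Num.bound (fine (mu (ball x (r + e / 2))) / c)).
  rewrite -[ltLHS]fineK ?ge0_fin_numE// lte_fin.
  rewrite -[ltRHS]mulr_natl -ltr_pdivrMr//.
  by rewrite archi_boundP// divr_ge0 ?fine_ge0// ltW.
have [U [mU Ux cU _]] := pack n.
rewrite ltNge => /negP; apply; apply: le_trans cU _.
by apply: le_measure; rewrite ?inE.
Qed.

(** An ultrafilter containing [A] contains a ball, so it is Cauchy and converges by completeness;
    closedness keeps the limit in [A]. *)
Lemma doubling_closed_bounded_compact (A : set X) :
  closed A -> bounded_in_metric A -> compact A.
Proof.
move=> clA [x [r Ar]]; rewrite compact_ultra => F UF FA.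
(* The radius witnessing boundedness need not be positive, hence the maximum with 1. *)
have Fx : F (ball x (Num.max r 1)).
  apply: filterS FA; apply: subset_trans Ar _; apply: le_ball.
  by rewrite le_max lexx.
have r1 : 0 < Num.max r 1 by rewrite lt_max ltr01 orbT.
have /cvg_ex[p Fp] : cvg F.
  by apply/cauchy_cvgP/cauchy_exP; exact: (ultra_ball_cauchy_ex UF r1 Fx).
exists p; split=> //; apply: clA => V /Fp FV.
exact: filter_ex (filterI FA FV).
Qed.

End doubling_compact.

(** * Division of chains and singleton impressions *)

Section chains.
Context {R : realType} {d : measure_display}
  {X : completeMetricMeasurableType R d}.
Implicit Types (Omega : set X) (E F : nat -> set X).

Lemma bounded_closure (A : set X) :
  bounded_in_metric A -> bounded_in_metric (closure A).
Proof.
move=> [x [r Ar]]; exists x, (r + 1) => y cAy.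
have [z [Az yz]] := cAy _ (nbhsx_ballx y 1 ltr01).
by apply: (ball_triangle (Ar _ Az)); exact: ball_sym.
Qed.

Lemma divides_trans E F G : divides E F -> divides F G -> divides E G.
Proof.
move=> EF FG k; have [l Fl] := FG k; have [m Em] := EF l.
by exists m; exact: subset_trans Em Fl.
Qed.

Lemma end_of_eq Omega E F :
  equivalent_chains E F -> end_of Omega E = end_of Omega F.
Proof.
move=> [EF FE]; apply/seteqP; split=> G [cG [dG Gd]]; split=> //; split;
  exact: divides_trans.
Qed.

Lemma chain_sub Omega E m n : chain Omega E -> (m <= n)%N -> E n `<=` E m.
Proof.
move=> [_ Edecr _ _] /subnK <-; elim: (n - m)%N => [//|i IH].
by apply: subset_trans IH; exact: Edecr.
Qed.

Lemma chain_nonempty Omega E k : chain Omega E -> E k !=set0.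
Proof.
move=> [/(_ k)[_ _ _ [z [Ez _]]] _ _ _].
by have [w [Ew _]] := Ez setT filterT; exists w.
Qed.

Lemma divides_singleton_impression (mu : {measure set X -> \bar R}) Omega E F x :
  borel_measurable_sets X ->
  (forall (x : X) (r : R), 0 < r -> (0 < mu (ball x r) < +oo)%E) ->
  doubling mu ->
  chain Omega E -> chain Omega F -> impression E = [set x] ->
  divides F E -> divides E F.
Proof.
move=> borel_mu mu_ball mu_doubling cE cF Ex FE k.
have [accE Edecr _ _] := cE; have [_ _ distF _] := cF.
absurd_not => nEF.
have [e e0 eF] : exists2 e : R, 0 < e &
    forall y z, (Omega `&` boundary (F k.+1)) y -> (Omega `&` boundary (F k)) z ->
      e <= mdist y z.
  have [r /andP[r0 rF]] : exists r : R, (0 < r%:E <= set_dist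
      (Omega `&` boundary (F k.+1)) (Omega `&` boundary (F k)))%E.
    (* The distance is infinite when one of the sets is empty; then any positive [e] will do. *)
    case: (set_dist _ _) (distF k) => [r r0|_|//]; first by exists r; rewrite r0/=.
    by exists 1; rewrite lte01 leey.
  exists r => // y z Fy Fz; rewrite -lee_fin; apply: le_trans rF _.
  by apply: ereal_inf_lbound; exists y => //; exists z.
have [l Elx] : exists l, closure (E l) `<=` ball x (e / 2).
  apply: nested_compact_sub.
  - apply: (doubling_closed_bounded_compact borel_mu mu_ball mu_doubling).
      exact: closed_closure.
    by have [Eb _ _ _] := accE 0%N; exact: bounded_closure.
  - by move=> i; exact: closed_closure.
  - by move=> i; exact: closureS.
  - exact: (@metric_ball_open R X).
  - by rewrite -/(impression E) Ex => _ ->; apply: ballxx; rewrite divr_gt0.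
have [_ Elc /properW ElO _] := accE l.
(* A late [F] lies in both [E l] and [F i], so these intersect; [E l] inside [F i] would put it
   inside [F k], against [nEF]. *)
have meets i : (k <= i)%N -> E l `&` boundary (F i) !=set0.
  move=> ki; apply: connected_meets_boundary => //.
    have [m Fm] := FE l; have [z Fz] := chain_nonempty (maxn i m) cF.
    exists z; split; [apply: Fm|]; apply: (chain_sub cF) Fz.
      exact: leq_maxr.
    exact: leq_maxl.
  move=> EFi; have [z Ez nFz] := nEF l; apply: nFz.
  exact: (chain_sub cF ki (EFi _ Ez)).
have [y [Ey Fy]] := meets _ (leqnSn k).
have [z [Ez Fz]] := meets _ (leqnn k).
have := eF y z (conj (ElO _ Ey) Fy) (conj (ElO _ Ez) Fz).
apply/negP; rewrite -ltNge.
have : ball y e z.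
  apply: (@ball_splitr _ _ x); apply: Elx; exact: subset_closure.
by rewrite ballEmdist.
Qed.

End chains.

Theorem proposition7p1 (R : realType) (d : measure_display)
    (X : completeMetricMeasurableType R d) (mu : {measure set X -> \bar R})
    (p : R) (Omega : set X)
    (more_than_one_point : exists a b : X, a <> b)
    (borel_mu : borel_measurable_sets X)
    (mu_ball : forall (x : X) (r : R), 0 < r ->
       (0 < mu (ball x r) < +oo)%E)
    (p_ge1 : 1 <= p)
    (mu_doubling : doubling mu)
    (X_poincare : poincare_inequality mu p)
    (Omega_domain : bounded_domain Omega)
    (Omega_proper : Omega `<` [set: X])
    (E : nat -> set X) (E_chain : chain Omega E)
    (x : X) (x_boundary : boundary Omega x)
    (singleton_impression : impression E = [set x]) :
  prime_end Omega (end_of Omega E).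
Proof.
split; first by exists E.
(* Division of ends is witnessed by representatives [F'] and [E']; it passes to [F] and [E] by
   transitivity. *)
move=> _ [F cF ->] nFE [F' [E' [[_ [FF' _]] [_ [_ E'E]] F'E']]].
have FE : divides F E.
  exact: divides_trans FF' (divides_trans F'E' E'E).
apply: nFE; apply: end_of_eq; split=> //.
exact: (divides_singleton_impression borel_mu mu_ball mu_doubling E_chain cF
  singleton_impression FE).
Qed.
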